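(* Let $n\ge 2$ and $\mathbb R^{n+1}_-:=\mathbb R^n\times(-\infty,0]$. There exists a smooth, parabolically convex function $u_1:\mathbb R^{n+1}_-\to\mathbb R$ satisfying \[ -(u_1)_t\,\det D^2u_1=1\quad\text{in }\mathbb R^{n+1}_-, \] such that there are no positive constants $m_1,m_2$ with \[ -m_1\le (u_1)_t(x,t)\le -m_2\quad\text{for all }(x,t)\in\mathbb R^{n+1}_- . \] Moreover, $u_1$ can be taken radially symmetric in $x$ and of variable separated form: there are functions $w:(-\infty,0]\to\mathbb R$ and $\varphi:[0,\infty)\to\mathbb R$ with \[ u_1(x,t)=w(t)\,\varphi(|x|)\quad\text{for all }(x,t)\in\mathbb R^{n+1}_- . \]
   Context: $u_t$ is the partial derivative in the time variable $t$ (one-sided at $t=0$), and $D^2u$ is the Hessian matrix in the space variable $x\in\mathbb R^n$. A function $u:\mathbb R^{n+1}_-\to\mathbb R$ is called parabolically convex if it is continuous, convex in $x$ and non-increasing in $t$. *)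

(* Defs.v *)
From HB Require Import structures.
From mathcomp Require Import all_boot all_order all_algebra.
From mathcomp Require Import all_classical all_reals all_analysis.

Set Implicit Arguments.
Unset Strict Implicit.
Unset Printing Implicit Defensive.

Import Order.TTheory GRing.Theory Num.Theory.
Import numFieldNormedType.Exports.

Local Open Scope classical_set_scope.
Local Open Scope ring_scope.

(* Functions on the closed lower half-space are represented by total functions
   on 'rV[R]_n * R; every notion below only involves their values at the points
   (x, t) with t <= 0. *)
Section Parabolic.
Variables (R : realType) (n : nat).
Implicit Types (u : 'rV[R]_n * R -> R) (p : 'rV[R]_n * R).

Definition lower_half_space : set ('rV[R]_n * R) := [set p | p.2 <= 0].

(* The library norm on 'rV[R]_n is the sup norm. *)
Definition enorm (x : 'rV[R]_n) : R := Num.sqrt (\sum_i x ord0 i ^+ 2).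

Definition derivable_x (i : 'I_n) u p : Prop :=
  derivable (fun x => u (x, p.2)) p.1 (delta_mx ord0 i).

Definition dx (i : 'I_n) u p : R :=
  'D_(delta_mx ord0 i) (fun x => u (x, p.2)) p.1.

(* The increments s - t are restricted by s <= 0, so that the time derivative
   is two-sided for t < 0 and one-sided (from the left) at t = 0. *)
Definition time_quotient u p (s : R) : R := (u (p.1, s) - u p) / (s - p.2).

Definition time_filter p : set_system R :=
  within [set s : R | s <= 0] (dnbhs p.2).

Definition derivable_t u p : Prop := cvg (time_quotient u p @ time_filter p).

Definition dt u p : R := lim (time_quotient u p @ time_filter p).

Definition hessian u p : 'M[R]_n := \matrix_(i, j) dx i (dx j u) p.

Fixpoint Ck (k : nat) u : Prop :=
  {within lower_half_space, continuous u} /\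
  if k is k'.+1 then
    [/\ forall i p, lower_half_space p -> derivable_x i u p,
        forall p, lower_half_space p -> derivable_t u p,
        forall i, Ck k' (dx i u)
      & Ck k' (dt u)]
  else True.

Definition smooth u : Prop := forall k, Ck k u.

Definition parabolically_convex u : Prop :=
  [/\ {within lower_half_space, continuous u},
      forall t : R, t <= 0 ->
        convex_function [set: 'rV[R]_n] (fun x => u (x, t))
    & forall (x : 'rV[R]_n) (s t : R),
        s <= t -> t <= 0 -> u (x, t) <= u (x, s)].

End Parabolic.

(* Main.v *)
Require Import Defs.
From mathcomp Require Import all_boot all_order all_algebra.
From mathcomp Require Import all_classical all_reals all_analysis.
From mathcomp Require Import ring lra.
Import Order.TTheory GRing.Theory Num.Theory.
Import numFieldNormedType.Exports.
Local Open Scope classical_set_scope.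
Local Open Scope ring_scope.

Set Implicit Arguments.
Unset Strict Implicit.
Unset Printing Implicit Defensive.

(** Why the theorem holds.  Look for u(x,t) = w(t) phi(|x|).  Writing n for
the dimension and N = n + 1, the equation splits into

  -w' w^n = 1   and   phi * det D^2(phi(|x|)) = 1.

The first one is solved by w(t) = (N (1 - t))^(1/N), which is smooth up to
t = 0, positive and decreasing.  Since w'(t) tends to 0 when t tends to minus
infinity, u_t(0,t) = w'(t) phi(0) admits no negative upper bound.

For the second one put q(r) = phi'(r)/r and q1(r) = q'(r)/r.  Then
D^2(phi(|x|)) = q I + q1 x x^T has determinant q^(n-1) (q + r^2 q1), so that,
with r = |x|, the equation reads (r^n q^n)' = n r^(n-1) / phi.  In terms of the
weighted averages

  A_m f(r) = (m+1) r^-(m+1) * integral of s^m f(s) over [0, r],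

normalised by phi(0) = 1, it is the fixed point problem

  phi = T phi,   T f = 1 + (r^2/2) A_1 ((A_(n-1) (1/f))^(1/n)).

Existence (lemma [profile_exists]): T reverses the order and contracts ratios:
if f <= (1+e) g on [-S, S], then T g <= (1+e)^(1/n) T f <= (1 + e/2) T f there,
because n >= 2.  All iterates of T starting at 1 lie between 1 and 1 + r^2/2,
so they converge geometrically, uniformly on every bounded interval.

Regularity (lemmas [radial_Ck_average] and [fixed_profile_smooth]):
x |-> f(|x|) is smooth at the origin as soon as the operator D f = f'/r can be
iterated on f with continuous results.  The averages commute with D up to a
constant and an increase of the weight, D (A_m f) = (m+1)/(m+3) A_(m+2) (D f),
so they preserve this class, and D phi = q = (A_(n-1) (1/phi))^(1/n) shows that
phi is one D-derivative more regular than it is known to be.  Working with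
functions of r on the whole line avoids one-sided derivatives at r = 0.

Convexity: the equation gives phi'' = q + r^2 q1 = 1 / (q^(n-1) phi) > 0, and
phi' = r q >= 0 on [0, +oo), so phi(|x|) is a nondecreasing convex function of
the Euclidean norm. *)

(** * Derivatives and primitives of real functions *)

Section PointwiseDerivatives.
Variables (R : realType) (V : normedModType R).
Implicit Types (f g : V -> R) (x v : V) (df dg c : R).

Lemma is_derive_mul f g x v df dg : is_derive x v f df -> is_derive x v g dg ->
  is_derive x v (fun y => f y * g y) (df * g x + f x * dg).
Proof.
move=> hf hg; have := is_deriveM hf hg.
by rewrite /GRing.scale/= [g x * df]mulrC addrC.
Qed.

Lemma is_derive_add f g x v df dg : is_derive x v f df -> is_derive x v g dg ->
  is_derive x v (fun y => f y + g y) (df + dg).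
Proof. exact: is_deriveD. Qed.

Lemma is_derive_mulcl f x v df c : is_derive x v f df ->
  is_derive x v (fun y => c * f y) (c * df).
Proof.
by move=> hf; have := is_derive_mul (is_derive_cst c x v) hf; rewrite mul0r add0r.
Qed.

Lemma is_derive_exprS f x v df m : is_derive x v f df ->
  is_derive x v (fun y => f y ^+ m.+1) (m.+1%:R * f x ^+ m * df).
Proof. by move=> hf; have := is_deriveX m.+1 hf; rewrite exprfctE. Qed.

Lemma is_derive_inv f x v df : f x != 0 -> is_derive x v f df ->
  is_derive x v (fun y => (f y)^-1) (- (f x) ^- 2 * df).
Proof.
move=> fx0 [dF <-]; apply: DeriveDef; first exact: derivableV.
by rewrite deriveV.
Qed.

End PointwiseDerivatives.

Section Primitives.
Variable R : realType.
Implicit Types (f g F G h : R -> R) (a b r : R).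

Lemma is_derive1_continuous F r (d : R) :
  is_derive r 1 F d -> {for r, continuous F}.
Proof.
by move=> [dF _]; apply: differentiable_continuous; apply/derivable1_diffP.
Qed.

(** Allowing either order of a and b lets the mean value point lie between 0 and
a radius of any sign. *)
Lemma cauchy_MVT_between F G f g a b : a != b ->
  (forall r, is_derive r 1 F (f r)) -> (forall r, is_derive r 1 G (g r)) ->
  exists2 c, Num.min a b < c < Num.max a b &
             (F b - F a) * g c = (G b - G a) * f c.
Proof.
move=> + dF dG; wlog ab : a b / a < b => [H|_].
  rewrite neq_lt => /orP[] ab; first by apply: H => //; rewrite lt_eqF.
  have [|c] := H b a ab; first by rewrite lt_eqF.
  by rewrite minC maxC => hc e; exists c => //; lra.
(* H takes the same value at a and b, so Rolle's argument applies to it. *)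
pose H r := (F b - F a) * G r - (G b - G a) * F r.
have dH r : is_derive r 1 H ((F b - F a) * g r - (G b - G a) * f r).
  by apply: is_deriveB; exact: is_derive_mulcl.
have [|c] := MVT ab (fun x _ => dH x).
  by apply: continuous_subspaceT => x; exact: is_derive1_continuous (dH x).
rewrite in_itv/= => hc e; exists c; first by rewrite min_l ?max_r// ltW.
have : ((F b - F a) * g c - (G b - G a) * f c) * (b - a) == 0.
  by rewrite -e /H; apply/eqP; ring.
by rewrite mulf_eq0 (subr_eq0 b a) (gt_eqF ab) orbF subr_eq0 => /eqP.
Qed.

Lemma eq_primitive_increment F G f g a b :
  (forall r, is_derive r 1 F (f r)) -> (forall r, is_derive r 1 G (g r)) ->
  f =1 g -> F b - F a = G b - G a.
Proof.
move=> dF dG fg.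
have dH r : is_derive r 1 (F - G) 0.
  have -> : 0 = f r - g r by rewrite fg subrr.
  exact: is_deriveB.
have /= := is_derive_0_is_cst b a dH.
by rewrite !fctE => e; rewrite -[F b](subrK (G b)) e; lra.
Qed.

(** The fundamental theorem of calculus, based at the left end -M. *)
Lemma primitive_above f (M : R) : continuous f -> exists F,
  forall r, - M < r -> is_derive r 1 F (f r).
Proof.
move=> cf; pose mu := @lebesgue_measure R.
exists (fun x => (\int[mu]_(t in [set` `[- M, x]]) (f t))%R) => r Mr.
have [||dF eF] := @continuous_FTC1_closed R f (- M) r (r + 1) _ _ Mr (cf r).
- by rewrite ltrDl.
- apply: continuous_compact_integrable; first exact: segment_compact.
  exact: continuous_subspaceT.
apply: (DeriveDef dF); rewrite -eF derive1E; reflexivity.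
Qed.

(** Near r, primitives based at far enough left ends differ by constants, so
those vanishing at 0 agree; the base |x| + 1 to the left of 0 is far enough for
both 0 and x. *)
Lemma primitive_exists f : continuous f ->
  exists2 F, F 0 = 0 & forall r, is_derive r 1 F (f r).
Proof.
move=> cf.
pose G M := sval (cid (primitive_above M cf)).
have dG M r : - M < r -> is_derive r 1 (G M) (f r) by exact: (svalP (cid (primitive_above M cf))).
have eG (M N r : R) : 0 < M -> - M < r -> M <= N -> G M r - G M 0 = G N r - G N 0.
  move=> M0 Mr MN.
  have dH x : - M < x -> is_derive x 1 (G M - G N) 0.
    move=> Mx; rewrite -(subrr (f x)); apply: is_deriveB; apply: dG => //.
    by apply: le_lt_trans Mx; rewrite lerN2.
  have H (a b : R) : - M < a -> a <= b -> (G M - G N) b = (G M - G N) a.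
    move=> Ma ab; have [||c _] := @MVT_segment R (G M - G N) (fun=> 0) a b ab.
    - by move=> x /[!in_itv]/= /andP[ax _]; apply: dH; apply: lt_trans ax.
    - apply: continuous_in_subspaceT => x /[!inE]/= /[!in_itv]/= /andP[ax _].
      by apply: is_derive1_continuous (dH x _); apply: lt_le_trans ax.
    by rewrite mul0r => /eqP; rewrite subr_eq0 => /eqP.
  have : (G M - G N) r = (G M - G N) 0.
    case: (leP 0 r) => [|/ltW] r0; first by apply: H r0; rewrite oppr_lt0.
    by apply/esym; apply: H.
  by rewrite !fctE; lra.
exists (fun x => G (`|x| + 1) x - G (`|x| + 1) 0); first by rewrite subrr.
move=> r; pose M : R := `|r| + 2.
have Mr : - M < r by rewrite /M; have := ler_norm (- r); rewrite normrN; lra.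
have dF : is_derive r 1 (fun x => G M x - G M 0) (f r).
  rewrite -[f r]subr0; apply: is_deriveB; exact: dG.
apply: near_eq_is_derive dF.
near=> x; apply/esym/eG.
- by rewrite ltr_wpDl.
- by have := ler_norm (- x); rewrite normrN => ?; lra.
- rewrite /M; suff : `|x| <= `|r| + 1 by lra.
  have h : `|r - x| < 1 by near: x; exact: (@cvgr_dist_lt R R _ (nbhs r) _ id r cvg_id).
  have := ler_normD (x - r) r; rewrite subrK distrC; lra.
Unshelve. all: by end_near. Qed.

End Primitives.

(** * Weighted averages of a continuous function over [0, r] *)

Section Averages.
Variable R : realType.
Implicit Types (f g F G h : R -> R) (a b r c : R) (m : nat).

Definition primitive f : R -> R :=
  xget (fun=> 0) [set F | F 0 = 0 /\ forall r, is_derive r 1 F (f r)].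

Lemma primitiveP f : continuous f ->
  primitive f 0 = 0 /\ forall r, is_derive r 1 (primitive f) (f r).
Proof.
move=> cf; have [F F0 dF] := primitive_exists cf.
exact: (@xgetPex _ (fun=> 0) [set F | F 0 = 0 /\ forall r, is_derive r 1 F (f r)]
  (ex_intro _ F (conj F0 dF))).
Qed.

Definition weighted m f : R -> R := fun s => m.+1%:R * s ^+ m * f s.

(** The value at r = 0 is the limit of the quotient.  For r < 0 the formula is
still an average of f, over [r, 0], whatever the parity of m. *)
Definition average m f r : R :=
  if r == 0 then f 0 else primitive (weighted m f) r / r ^+ m.+1.

Lemma weighted_continuous m f : continuous f -> continuous (weighted m f).
Proof.
move=> cf r; apply: cvgM; last exact: cf.
by apply: cvgM; [exact: cvg_cst|exact: exprn_continuous].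
Qed.

Lemma is_derive_pow m r : is_derive r 1 (fun s : R => s ^+ m.+1) (m.+1%:R * r ^+ m).
Proof.
by have := is_derive_exprS m (is_derive_id r 1); rewrite mulr1.
Qed.

Lemma averageE m f F r : continuous f -> F 0 = 0 ->
  (forall r, is_derive r 1 F (weighted m f r)) ->
  average m f r * r ^+ m.+1 = F r.
Proof.
move=> cf F0 dF; rewrite /average; have [->|r0] := eqVneq r 0.
  by rewrite expr0n/= mulr0 F0.
have [P0 dP] := primitiveP (weighted_continuous (m := m) cf).
rewrite divfK ?expf_neq0//.
by have := eq_primitive_increment 0 r dP dF (fun=> erefl); rewrite P0 F0 !subr0.
Qed.

Lemma average_eq m f r a : continuous f -> r != 0 ->
  a * r ^+ m.+1 = primitive (weighted m f) r -> average m f r = a.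
Proof. by move=> cf r0 e; rewrite /average (negbTE r0) -e mulfK// expf_neq0. Qed.

(** Cauchy's mean value theorem for the primitive of (m+1) s^m f(s) against
s^(m+1): the weights cancel, and with them all questions of sign for r < 0. *)
Lemma average_mean m f r : continuous f ->
  exists2 c, `|c| <= `|r| & average m f r = f c.
Proof.
move=> cf; have [->|r0] := eqVneq r 0; first by exists 0; rewrite // /average eqxx.
have [P0 dP] := primitiveP (weighted_continuous (m := m) cf).
have [|c] := cauchy_MVT_between _ dP (is_derive_pow m) (a := 0) (b := r).
  by rewrite eq_sym.
rewrite P0 expr0n/= !subr0 => /andP[c1 c2] e.
have c0 : c != 0.
  apply/eqP => c0; move: c1 c2; rewrite c0; case: (ltgtP 0 r) => // *; lra.
exists c.
  move: c1 c2; case: (ltgtP 0 r) => // r1 c1 c2; last lra.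
    by rewrite !ger0_norm ?ltW.
  by rewrite !ler0_norm ?lerN2 ?ltW.
apply: average_eq => //.
(* c lies strictly between 0 and r, so the weight at c can be divided out. *)
have w0 : m.+1%:R * c ^+ m != 0 by rewrite mulf_neq0// ?expf_neq0// pnatr_eq0.
apply: (mulIf w0); rewrite e /weighted; ring.
Qed.

Lemma averageB m f g r : continuous f -> continuous g ->
  average m (fun s => f s - g s) r = average m f r - average m g r.
Proof.
move=> cf cg; have cfg : continuous (fun s => f s - g s).
  by move=> s; apply: cvgB; [exact: cf|exact: cg].
have [->|r0] := eqVneq r 0; first by rewrite /average eqxx.
have [P0 dP] := primitiveP (weighted_continuous (m := m) cf).
have [Q0 dQ] := primitiveP (weighted_continuous (m := m) cg).
apply: (mulIf (expf_neq0 m.+1 r0)); rewrite mulrBl.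
rewrite (averageE r cf P0 dP) (averageE r cg Q0 dQ).
apply: (averageE (F := primitive (weighted m f) - primitive (weighted m g)) r cfg).
  by rewrite !fctE P0 Q0 subrr.
by move=> s; rewrite [X in is_derive _ _ _ X]mulrBr; exact: is_deriveB.
Qed.

Lemma averageZ m c f r : continuous f ->
  average m (fun s => c * f s) r = c * average m f r.
Proof.
move=> cf; have ccf : continuous (fun s => c * f s).
  by move=> s; apply: cvgM; [exact: cvg_cst|exact: cf].
have [->|r0] := eqVneq r 0; first by rewrite /average eqxx.
have [P0 dP] := primitiveP (weighted_continuous (m := m) cf).
apply: (mulIf (expf_neq0 m.+1 r0)); rewrite -mulrA (averageE r cf P0 dP).
apply: (averageE (F := fun s => c * primitive (weighted m f) s) r ccf).
  by rewrite P0 mulr0.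
by move=> s; rewrite /weighted mulrCA; exact: is_derive_mulcl.
Qed.

Lemma le_average m f g r : continuous f -> continuous g ->
  (forall s, `|s| <= `|r| -> f s <= g s) -> average m f r <= average m g r.
Proof.
move=> cf cg fg; rewrite -subr_ge0 -averageB//.
have cfg : continuous (fun s => g s - f s).
  by move=> s; apply: cvgB; [exact: cg|exact: cf].
by have [c hc ->] := average_mean m r cfg; rewrite subr_ge0 fg.
Qed.

Lemma is_derive_pow_average m f r : continuous f ->
  is_derive r 1 (fun s => average m f s * s ^+ m.+1) (weighted m f r).
Proof.
move=> cf; have [P0 dP] := primitiveP (weighted_continuous (m := m) cf).
by rewrite (_ : (fun _ => _) = primitive (weighted m f))//; apply/funext => s; exact: averageE.
Qed.

Lemma is_derive_average_neq0 m f r : continuous f -> r != 0 ->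
  is_derive r 1 (average m f) (m.+1%:R * (f r - average m f r) / r).
Proof.
move=> cf r0; have rm0 := expf_neq0 m.+1 r0.
have dV : is_derive r 1 (fun s : R => (s ^+ m.+1)^-1)
    (- (r ^+ m.+1) ^- 2 * (m.+1%:R * r ^+ m)).
  exact: is_derive_inv (is_derive_pow m r).
have H := is_derive_mul (is_derive_pow_average m r cf) dV.
apply: (@near_eq_is_derive _ _ _ _ _ _ _ _ _ (is_derive_eq H _)); last first.
  by rewrite /weighted !exprS; field; rewrite r0 ?expf_neq0.
near=> s; rewrite /= mulfK// expf_neq0//; near: s.
by apply: open_nbhs_nbhs; split => //; exact: open_neq.
Unshelve. all: by end_near. Qed.

(** At 0 the average is a value of f at a point no farther from 0 than r. *)
Lemma average_continuous m f : continuous f -> continuous (average m f).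
Proof.
move=> cf r; have [->|r0] := eqVneq r 0; last first.
  exact: is_derive1_continuous (is_derive_average_neq0 m cf r0).
apply/cvgrPdist_lt => e e0.
have /cvgrPdist_lt /(_ _ e0) /nbhs_normP [d /= d0 H] := cf 0.
near=> s; have [c cs ->] := average_mean m s cf.
have [c' + ->] := average_mean m 0 cf; rewrite normr0 normr_le0 => /eqP ->.
apply: H; rewrite /= sub0r normrN; apply: le_lt_trans cs _; near: s.
exact: (@cvgr0_norm_lt R R _ (nbhs (0 : R)) _ id cvg_id d d0).
Unshelve. all: by end_near. Qed.

End Averages.

(** * Regularity of radial functions *)

Section RadialRegularity.
Variable R : realType.
Implicit Types (f g h : R -> R) (a b r c : R) (m k : nat).

(** The operator D f = f'/r can be applied k times to f with continuous results.
The factor r forces f'(0) = 0, which is what makes x |-> f(|x|) differentiable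
at the origin; iterating, it makes it of class C^k there. *)
Fixpoint radial_Ck k f : Prop :=
  continuous f /\
  if k is k'.+1 then
    exists2 h, radial_Ck k' h & forall r, is_derive r 1 f (r * h r)
  else True.

Lemma radial_Ck_continuous k f : radial_Ck k f -> continuous f.
Proof. by case: k => [|k] []. Qed.

Lemma radial_CkS k f : radial_Ck k.+1 f -> radial_Ck k f.
Proof.
elim: k f => [|k IH] f [cf [h hh df]]; split=> //.
by exists h => //; exact: IH.
Qed.

Lemma radial_Ck_cst k c : radial_Ck k (fun=> c).
Proof.
elim: k c => [|k IH] c; split=> //; try exact: cst_continuous.
by exists (fun=> 0); [exact: IH|move=> r; rewrite mulr0; exact: is_derive_cst].
Qed.

Lemma radial_Ck_add k f g :
  radial_Ck k f -> radial_Ck k g -> radial_Ck k (fun r => f r + g r).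
Proof.
elim: k f g => [|k IH] f g hf hg.
  split=> // r; apply: cvgD; [exact: radial_Ck_continuous hf r|exact: radial_Ck_continuous hg r].
case: hf hg => [cf [hf Hf df]] [cg [hg Hg dg]]; split=> [r|].
  by apply: cvgD; [exact: cf|exact: cg].
exists (fun r => hf r + hg r); first exact: IH.
by move=> r; rewrite mulrDr; exact: is_derive_add.
Qed.

Lemma radial_Ck_mul k f g :
  radial_Ck k f -> radial_Ck k g -> radial_Ck k (fun r => f r * g r).
Proof.
elim: k f g => [|k IH] f g Cf Cg.
  split=> // r; apply: cvgM; [exact: radial_Ck_continuous Cf r|exact: radial_Ck_continuous Cg r].
have [Lf Lg] := (radial_CkS Cf, radial_CkS Cg).
case: Cf Cg => [cf [hf Hf df]] [cg [hg Hg dg]]; split=> [r|].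
  by apply: cvgM; [exact: cf|exact: cg].
exists (fun r => hf r * g r + f r * hg r).
  by apply: radial_Ck_add; exact: IH.
move=> r; rewrite mulrDr mulrA [r * (f r * _)]mulrCA; exact: is_derive_mul.
Qed.

Lemma is_derive_powR f r (d a : R) : 0 < f r -> is_derive r 1 f d ->
  is_derive r 1 (fun s => f s `^ a) (a * f r `^ (a - 1) * d).
Proof. by move=> fr df; exact: is_derive1_comp (is_derive1_powR a fr) df. Qed.

Lemma continuous_powR f a r : 0 < f r -> {for r, continuous f} ->
  {for r, continuous (fun s => f s `^ a)}.
Proof.
move=> fr cf; apply: (@continuous_comp _ _ _ f (fun s => s `^ a)) => //.
exact: is_derive1_continuous (is_derive1_powR a fr).
Qed.

Lemma radial_Ck_powR k f a : (forall r, 0 < f r) -> radial_Ck k f ->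
  radial_Ck k (fun r => f r `^ a).
Proof.
move=> f0; elim: k a => [|k IH] a Cf.
  split=> // r; apply: continuous_powR => //; exact: radial_Ck_continuous Cf r.
have Lf := radial_CkS Cf.
case: Cf => [cf [h Ch dh]]; split=> [r|].
  by apply: continuous_powR => //; exact: cf.
exists (fun r => a * f r `^ (a - 1) * h r).
  do 2 apply: radial_Ck_mul => //; first exact: radial_Ck_cst.
  exact: IH.
by move=> r; rewrite mulrCA; exact: is_derive_powR.
Qed.

(** Cauchy's mean value theorem against r^2, so that D f takes the place of f'.
The sign condition keeps the mean value point away from 0, where r^2 is
stationary. *)
Lemma radial_MVT f h a b : 0 <= a * b ->
  (forall r, is_derive r 1 f (r * h r)) ->
  exists2 c, Num.min a b <= c <= Num.max a b &
             f b - f a = h c * ((b ^+ 2 - a ^+ 2) / 2).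
Proof.
move=> ab df; have [->|ne] := eqVneq a b.
  by exists b; [rewrite minxx maxxx lexx|rewrite !subrr mul0r mulr0].
have [c /andP[c1 c2]] := cauchy_MVT_between ne df (is_derive_pow 1).
rewrite expr1 => e; exists c; first by rewrite !ltW.
have c0 : c != 0.
  apply/eqP => c0; move: c1 c2; rewrite c0; case: (ltgtP a b) ne => // ltab _ h1 h2.
    by move: ab; rewrite leNgt nmulr_rlt0 ?h2.
  by move: ab; rewrite leNgt pmulr_rlt0 ?h1.
by apply: (mulIf c0); move: e => /=; lra.
Qed.

Lemma is_derive_of_cvg (V : normedModType R) (f : V -> R) x v (df : R) :
  (fun t => t^-1 *: (f (t *: v + x) - f x)) @ 0^' --> df -> is_derive x v f df.
Proof.
by move=> H; apply: DeriveDef; [exact: cvgP H|exact: cvg_lim H].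
Qed.

(** The identity D (A_m f) = (m+1)/(m+3) A_(m+2) (D f).  For r <> 0 it is an
integration by parts: (m+3) (f - A_m f) r^(m+1) is a primitive of
(m+3) s^(m+2) D f(s).  At r = 0 the increment of A_m f is an increment of f
over a shorter radius, hence of order r^2. *)
Lemma is_derive_average m f h r : continuous f -> continuous h ->
  (forall r, is_derive r 1 f (r * h r)) ->
  is_derive r 1 (average m f) (r * (m.+1%:R / m.+3%:R * average m.+2 h r)).
Proof.
move=> cf ch df; have [->|r0] := eqVneq r 0; last first.
  apply: is_derive_eq (is_derive_average_neq0 m cf r0) _.
  have dF (s : R) : is_derive s 1
      (fun t => m.+3%:R * (f t * t ^+ m.+1 - average m f t * t ^+ m.+1))
      (weighted m.+2 h s).
    apply: is_derive_eq.
      apply: is_derive_mulcl; apply: is_deriveB.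
        exact: is_derive_mul (df s) (is_derive_pow m s).
      exact: is_derive_pow_average.
    by rewrite /weighted !exprS; ring.
  have := averageE r ch _ dF; rewrite !expr0n/= !mulr0 subrr mulr0 => /(_ erefl).
  have m3 : m.+3%:R != 0 :> R by rewrite pnatr_eq0.
  rewrite 2!exprSr -mulrBl [RHS]mulrA => e.
  suff -> : average m.+2 h r = m.+3%:R * (f r - average m f r) / r ^+ 2.
    by field; rewrite r0 -natrD pnatr_eq0.
  apply: (mulIf (expf_neq0 2 r0)); rewrite divfK ?expf_neq0//.
  by apply: (mulIf (expf_neq0 m.+1 r0)); rewrite -e !exprS; ring.
rewrite mul0r; apply: is_derive_of_cvg; apply/cvgrPdist_lt => e e0.
have /cvgrPdist_lt /(_ _ ltr01) /nbhs_normP [d /= d0 H] := ch 0.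
pose M := `|h 0| + 1; have M0 : 0 < M by rewrite ltr_wpDl.
near=> t.
have t0 : t != 0 by near: t; exact: nbhs_dnbhs_neq.
rewrite sub0r normrN [_ *: _]mulrC addr0 [t *: 1]mulr1 normrM normfV.
have [c ct ->] := average_mean m t cf.
have [c' + ->] := average_mean m 0 cf; rewrite normr0 normr_le0 => /eqP ->.
have [|z hz ->] := @radial_MVT f h 0 c _ df; first by rewrite mul0r.
have zc : `|z| <= `|c|.
  move: hz; case: (ltgtP 0 c) => [c0|c0|<-] /andP[z1 z2].
  - by rewrite !ger0_norm// ltW.
  - by rewrite !ler0_norm ?lerN2// ltW.
  - by have -> : z = 0 by apply/eqP; rewrite eq_le z1 z2.
have hM : `|h z| <= M.
  have : `|h 0 - h z| < 1.
    apply: H; rewrite /= sub0r normrN (le_lt_trans zc)// (le_lt_trans ct)//.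
    by near: t; exact: dnbhs0_lt.
  by rewrite /M distrC; have := ler_normD (h z - h 0) (h 0); rewrite subrK; lra.
rewrite expr0n/= subr0 normrM [`|c ^+ 2 / 2|]ger0_norm; last first.
  by rewrite divr_ge0// sqr_ge0.
have nt0 : 0 < `|t| by rewrite normr_gt0.
have te : `|t| < e / M by near: t; apply: dnbhs0_lt; rewrite divr_gt0.
rewrite ltr_pdivlMr // in te; rewrite ltr_pdivrMr //.
have c2 : c ^+ 2 <= `|t| ^+ 2 by rewrite -real_normK ?num_real// ler_sqr ?nnegrE.
have : `|h z| * c ^+ 2 <= M * `|t| ^+ 2 by apply: ler_pM; rewrite ?sqr_ge0.
have : `|t| * M * `|t| < e * `|t| by rewrite ltr_pM2r.
have : 0 <= `|h z| * c ^+ 2 by rewrite mulr_ge0 ?sqr_ge0.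
by rewrite expr2; lra.
Unshelve. all: by end_near. Qed.

Lemma radial_Ck_average m k f : radial_Ck k f -> radial_Ck k (average m f).
Proof.
elim: k m f => [|k IH] m f Cf.
  by split=> //; apply: average_continuous; exact: radial_Ck_continuous Cf.
case: Cf => [cf [h Ch dh]]; split; first exact: average_continuous.
exists (fun r => m.+1%:R / m.+3%:R * average m.+2 h r).
  by apply: radial_Ck_mul; [exact: radial_Ck_cst|exact: IH].
by move=> r; apply: is_derive_average => //; exact: radial_Ck_continuous Ch.
Qed.

End RadialRegularity.

(** * The fixed point problem for the profile *)

Section FixedPoint.
Variable R : realType.
Implicit Types (f g : R -> R) (r S e C : R).

Lemma exists_half_pow_lt C e : 0 <= C -> 0 < e -> exists j, C / 2 ^+ j < e.
Proof.
move=> C0 e0; exists (Num.truncn (C / e)).+1.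
rewrite ltr_pdivrMr ?exprn_gt0// -ltr_pdivrMl// mulrC.
apply: lt_trans (truncnS_gt _) _.
by rewrite -natrX ltr_nat ltn_expl.
Qed.

Lemma eq_of_half_pow (x y : R) C : 0 <= C -> (forall j, `|x - y| <= C / 2 ^+ j) -> x = y.
Proof.
move=> C0 H; apply/eqP; rewrite -subr_eq0 -normr_eq0 eq_le normr_ge0 andbT.
rewrite leNgt; apply/negP => /(exists_half_pow_lt C0)[j]; rewrite ltNge.
by rewrite H.
Qed.

(** The sequences u_j - 2C/2^j and u_j + 2C/2^j are respectively nondecreasing
and nonincreasing; the limit is the supremum of the first. *)
Lemma half_pow_cauchy (u : nat -> R) C : 0 <= C ->
  (forall j, `|u j.+1 - u j| <= C / 2 ^+ j) ->
  exists l, forall j, `|l - u j| <= 2 * C / 2 ^+ j.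
Proof.
move=> C0 H; pose d j := u j - 2 * C / 2 ^+ j; pose c j := u j + 2 * C / 2 ^+ j.
have hS j : 2 * C / 2 ^+ j.+1 = C / 2 ^+ j.
  by rewrite [2 ^+ j.+1]exprS; field; rewrite expf_neq0.
have h2 j : 2 * C / 2 ^+ j = C / 2 ^+ j + C / 2 ^+ j by rewrite -mulrA; lra.
have dS : {homo d : i j / (i <= j)%N >-> i <= j}.
  apply: (homo_leq (@lexx _ _) (@le_trans _ _)) => j.
  by rewrite /d hS h2; move: (H j); rewrite ler_norml => /andP[]; lra.
have cS : {homo c : i j / (i <= j)%N >-> j <= i}.
  apply: (homo_leq (@lexx _ _)) => [x y z xy yz|j]; first exact: le_trans yz xy.
  by rewrite /c hS h2; move: (H j); rewrite ler_norml => /andP[]; lra.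
have dc i j : d i <= c j.
  apply: le_trans (dS _ _ (leq_maxl i j)) _; apply: le_trans (cS _ _ (leq_maxr i j)).
  by rewrite /d /c lerD2l ge0_cp// divr_ge0 ?exprn_ge0// mulr_ge0.
have cub j : ubound (range d) (c j) by move=> _ [i _ <-].
exists (sup (range d)) => j; rewrite ler_norml.
have h1 : sup (range d) <= c j by apply: ge_sup; [exists (d 0%N); exists 0%N|exact: cub].
have : d j <= sup (range d).
  by apply: ub_le_sup; [exists (c 0%N); exact: cub|exists j].
by move: h1; rewrite /c /d => h1 h3; apply/andP; split; lra.
Qed.

(** In dimension m + 1, the quotient phi'(r)/r of a solution phi. *)
Definition slope m f : R -> R :=
  fun r => average m (fun s => (f s)^-1) r `^ m.+1%:R^-1.

(** Up to the constant 1, the primitive of r * slope m f r vanishing at 0. *)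
Definition profile_map m f : R -> R :=
  fun r => 1 + r ^+ 2 / 2 * average 1 (slope m f) r.

Definition admissible f := continuous f /\ forall r, 1 <= f r.

Lemma admissible_inv_continuous f : admissible f -> continuous (fun s => (f s)^-1).
Proof.
move=> [cf f1] s; apply: cvgV; last exact: cf.
by rewrite gt_eqF// (lt_le_trans ltr01).
Qed.

Lemma average_inv_gt0 m f r : admissible f -> 0 < average m (fun s => (f s)^-1) r.
Proof.
move=> af; have [c _ ->] := average_mean m r (admissible_inv_continuous af).
by rewrite invr_gt0 (lt_le_trans ltr01)//; case: af.
Qed.

Lemma slope_gt0 m f r : admissible f -> 0 < slope m f r.
Proof. by move=> af; rewrite powR_gt0// average_inv_gt0. Qed.

Lemma slope_le1 m f r : admissible f -> slope m f r <= 1.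
Proof.
move=> af; rewrite /slope; have := average_inv_gt0 m r af.
have [c _ ->] := average_mean m r (admissible_inv_continuous af) => h.
rewrite -[leRHS](powRr0 (f c)^-1); apply: ger_powR; last first.
  by rewrite invr_ge0.
by rewrite h/= invf_le1; case: af => // _ f1; rewrite (lt_le_trans ltr01).
Qed.

Lemma slope_continuous m f : admissible f -> continuous (slope m f).
Proof.
move=> af r; apply: continuous_powR; first exact: average_inv_gt0.
exact: average_continuous (admissible_inv_continuous af) r.
Qed.

Lemma profile_map_admissible m f : admissible f -> admissible (profile_map m f).
Proof.
move=> af; have cs := slope_continuous (m := m) af; split=> [r|r].
  apply: cvgD; first exact: cvg_cst.
  apply: cvgM; last exact: average_continuous.
  by apply: cvgM; [exact: exprn_continuous|exact: cvg_cst].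
rewrite lerDl mulr_ge0// ?divr_ge0 ?sqr_ge0//.
by have [c _ ->] := average_mean 1 r cs; rewrite ltW// slope_gt0.
Qed.

Lemma profile_map_le m f r : admissible f -> profile_map m f r <= 1 + r ^+ 2 / 2.
Proof.
move=> af; rewrite lerD2l ler_piMr ?divr_ge0 ?sqr_ge0//.
by have [c _ ->] := average_mean 1 r (slope_continuous (m := m) af); exact: slope_le1.
Qed.

(** A root of order at least 2 at least halves the distance to 1, because
(1 + e/2)^2 >= 1 + e: the hypothesis n >= 2 makes the iteration contract. *)
Lemma powR_root_le m e : (0 < m)%N -> 0 <= e ->
  (1 + e) `^ m.+1%:R^-1 <= 1 + e / 2.
Proof.
move=> m0 e0; have h0 : 1 <= 1 + e / 2 by lra.
have : 1 + e <= (1 + e / 2) ^+ m.+1.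
  apply: (@le_trans _ _ ((1 + e / 2) ^+ 2)); first by have := sqr_ge0 e; lra.
  exact: ler_weXn2l.
have r0 : 0 <= m.+1%:R^-1 :> R by rewrite invr_ge0.
move=> /(ge0_ler_powR r0); rewrite !nnegrE => h; apply: le_trans (h _ _) _.
- by rewrite addr_ge0.
- by rewrite exprn_ge0// (le_trans ler01).
by rewrite -powR_mulrn ?(le_trans ler01)// -powRrM divff ?pnatr_eq0// powRr1// (le_trans ler01).
Qed.

(** The contraction estimate, in terms of ratios: inverting f exchanges the roles
of f and g, averaging keeps the factor, and the root brings 1 + e down to
1 + e/2.  Ratios fit here because they pass through inverses and roots with no
loss, and the added constant 1 only improves them. *)
Lemma profile_map_antitone m f g S e : (0 < m)%N -> 0 <= e ->
  admissible f -> admissible g ->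
  (forall s, `|s| <= S -> f s <= (1 + e) * g s) ->
  forall r, `|r| <= S -> profile_map m g r <= (1 + e / 2) * profile_map m f r.
Proof.
move=> m0 e0 af ag fg r rS; have e1 : 0 < 1 + e by rewrite ltr_pwDl.
have f0 s : 0 < f s by rewrite (lt_le_trans ltr01)//; case: af.
have g0 s : 0 < g s by rewrite (lt_le_trans ltr01)//; case: ag.
have sl s : `|s| <= `|r| -> slope m g s <= (1 + e / 2) * slope m f s.
  move=> sr; have cif := admissible_inv_continuous af.
  have h : average m (fun s => (g s)^-1) s <=
      (1 + e) * average m (fun s => (f s)^-1) s.
    rewrite -averageZ//; apply: le_average.
    - exact: admissible_inv_continuous.
    - by move=> x; apply: cvgM; [exact: cvg_cst|exact: cif].
    move=> x xs; rewrite -[(g x)^-1]mul1r ler_pdivrMr// mulrAC ler_pdivlMr// mul1r.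
    by apply: fg; apply: le_trans rS; exact: le_trans sr.
  have af0 := ltW (average_inv_gt0 m s af); have ag0 := ltW (average_inv_gt0 m s ag).
  have r0 : 0 <= m.+1%:R^-1 :> R by rewrite invr_ge0.
  have := ge0_ler_powR r0 ag0 _ h; rewrite nnegrE => /(_ (mulr_ge0 (ltW e1) af0)).
  rewrite powRM ?(ltW e1)// => /le_trans; apply.
  by rewrite ler_wpM2r ?powR_ge0// powR_root_le.
have cf := slope_continuous (m := m) af; have cg := slope_continuous (m := m) ag.
have : average 1 (slope m g) r <= (1 + e / 2) * average 1 (slope m f) r.
  rewrite -averageZ//; apply: le_average => // x.
  by apply: cvgM; [exact: cvg_cst|exact: cf].
rewrite /profile_map; move: (average 1 _ r) (average 1 _ r) => B A BA.
have := ler_wpM2l (divr_ge0 (sqr_ge0 r) (ler0n R 2)) BA.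
by rewrite mulrDr [_ * (r ^+ 2 / 2 * _)]mulrCA; lra.
Qed.

Definition profile_iter m j : R -> R := iter j (profile_map m) (fun=> 1).

Lemma profile_iter_admissible m j : admissible (profile_iter m j).
Proof.
elim: j => [|j IH]; last exact: profile_map_admissible.
by split=> // r; exact: cvg_cst.
Qed.

(** The initial ratio is that of 1 and T 1, which lies in [1, 1 + S^2/2]. *)
Lemma profile_iter_ratio m S j : (0 < m)%N -> forall r, `|r| <= S ->
  let e := S ^+ 2 / 2 / 2 ^+ j in
  profile_iter m j r <= (1 + e) * profile_iter m j.+1 r /\
  profile_iter m j.+1 r <= (1 + e) * profile_iter m j r.
Proof.
move=> m0; elim: j => [|j IH] r rS /=.
  have [_ /(_ r) h1] := profile_iter_admissible m 1.
  have h2 := profile_map_le m r (profile_iter_admissible m 0).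
  have h3 : r ^+ 2 <= S ^+ 2.
    by rewrite -real_normK ?num_real// ler_sqr ?nnegrE// (le_trans _ rS).
  have h4 := sqr_ge0 S; rewrite expr0 divr1 mulr1; split.
    have z0 : 0 <= S ^+ 2 / 2 by lra.
    have := mulr_ge0 z0 (le_trans ler01 h1); move: h1 => /=; rewrite /profile_iter/=; lra.
  apply: le_trans h2 _; lra.
have e0 : 0 <= S ^+ 2 / 2 / 2 ^+ j by rewrite !divr_ge0 ?sqr_ge0// exprn_ge0.
have -> : S ^+ 2 / 2 / 2 ^+ j.+1 = S ^+ 2 / 2 / 2 ^+ j / 2.
  by rewrite [2 ^+ j.+1]exprS; field; rewrite expf_neq0.
by split; apply: profile_map_antitone rS => //;
  try exact: profile_iter_admissible; try (exact: (profile_iter_admissible m j.+1));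
  move=> s /IH[].
Qed.

Lemma le_of_ratio (x y d M : R) : 0 <= d -> x <= M -> y <= M ->
  x <= (1 + d) * y -> y <= (1 + d) * x -> `|x - y| <= M * d.
Proof.
move=> d0 xM yM xy yx; rewrite ler_norml.
have := ler_wpM2r d0 xM; have := ler_wpM2r d0 yM => h1 h2.
by apply/andP; split; lra.
Qed.

Lemma profile_iter_le m j r S : `|r| <= S -> profile_iter m j r <= 1 + S ^+ 2 / 2.
Proof.
move=> rS; have h3 : r ^+ 2 <= S ^+ 2.
  by rewrite -real_normK ?num_real// ler_sqr ?nnegrE// (le_trans _ rS).
case: j => [|j]; first by rewrite lerDl divr_ge0 ?sqr_ge0.
apply: le_trans (profile_map_le m r (profile_iter_admissible m j)) _; lra.
Qed.

(** The ratio bounds become additive ones because the iterates are bounded by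
1 + S^2/2 on [-S, S]. *)
Lemma profile_limit m : (0 < m)%N -> exists phi : R -> R, forall S,
  exists2 C, 0 <= C & forall r j, `|r| <= S -> `|phi r - profile_iter m j r| <= C / 2 ^+ j.
Proof.
move=> m0; pose K S : R := S ^+ 2 / 2; pose C S := (1 + K S) * K S.
have K0 S : 0 <= K S by rewrite divr_ge0 ?sqr_ge0.
have C0 S : 0 <= C S by rewrite mulr_ge0// addr_ge0.
have step S r j : `|r| <= S ->
    `|profile_iter m j.+1 r - profile_iter m j r| <= C S / 2 ^+ j.
  move=> rS; have [h1 h2] := profile_iter_ratio j m0 rS.
  rewrite /C -mulrA; apply: le_of_ratio => //; try exact: profile_iter_le.
  by rewrite divr_ge0// exprn_ge0.
have lim S r : exists l, `|r| <= S ->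
    forall j, `|l - profile_iter m j r| <= 2 * C S / 2 ^+ j.
  case: (boolP (`|r| <= S)) => [rS|_]; last by exists 0.
  by have [l hl] := half_pow_cauchy (C0 S) (fun j => step S r j rS); exists l.
(* One pointwise limit for each r; the choice S = |r| gives the smallest of
   the bounds available at r, so it implies those for all S >= |r|. *)
pose phi r := sval (cid (lim `|r| r)).
have hphi r j : `|phi r - profile_iter m j r| <= 2 * C `|r| / 2 ^+ j.
  by apply: (svalP (cid (lim `|r| r))).
exists phi => S; exists (2 * C S); first by rewrite mulr_ge0.
move=> r j rS; apply: le_trans (hphi r j) _.
rewrite ler_wpM2r ?invr_ge0 ?exprn_ge0// ler_wpM2l//.
have h : K `|r| <= K S.
  by rewrite /K ler_wpM2r// ler_sqr ?nnegrE// (le_trans _ rS).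
by apply: ler_pM; rewrite ?addr_ge0// lerD2l.
Qed.

Lemma profile_limit_continuous m phi :
  (forall S, exists2 C, 0 <= C &
    forall r j, `|r| <= S -> `|phi r - profile_iter m j r| <= C / 2 ^+ j) ->
  continuous phi.
Proof.
move=> H r; have [C C0 HC] := H (`|r| + 1); apply/cvgrPdist_lt => e e0.
have e3 : 0 < e / 3 by lra.
have [j hj] := exists_half_pow_lt C0 e3.
have [cj _] := profile_iter_admissible m j.
have := cj r => /cvgrPdist_lt/(_ _ e3) cjr.
near=> s.
have s1 : `|s| <= `|r| + 1.
  have h : `|r - s| < 1 by near: s; exact: (@cvgr_dist_lt R R _ (nbhs r) _ id r cvg_id).
  by have := ler_normD (s - r) r; rewrite subrK distrC; lra.
have h1 := HC s j s1; have h2 : `|phi r - profile_iter m j r| <= C / 2 ^+ j.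
  by apply: HC; lra.
have h3 : `|profile_iter m j r - profile_iter m j s| < e / 3 by near: s; exact: cjr.
have -> : phi r - phi s = (phi r - profile_iter m j r) +
    (profile_iter m j r - profile_iter m j s) - (phi s - profile_iter m j s) by lra.
apply: le_lt_trans (ler_normB _ _) _.
by have := ler_normD (phi r - profile_iter m j r) (profile_iter m j r - profile_iter m j s); lra.
Unshelve. all: by end_near. Qed.

(** The limit is a fixed point because T contracts the ratio between phi and an
iterate, so that T phi and phi are both close to the next iterate. *)
Lemma profile_exists m : (0 < m)%N ->
  exists2 phi, admissible phi & forall r, phi r = profile_map m phi r.
Proof.
move=> m0; have [phi H] := profile_limit m0.
have aphi : admissible phi.
  split; first exact: profile_limit_continuous H.
  move=> r; rewrite leNgt; apply/negP => phi1.
  have [C C0 HC] := H `|r|.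
  have [|j hj] := @exists_half_pow_lt C (1 - phi r) C0; first by rewrite subr_gt0.
  have [_ /(_ r)] := profile_iter_admissible m j.
  by have := HC r j (lexx _); rewrite ler_norml => /andP[]; lra.
exists phi => // r; have [C C0 HC] := H `|r|.
pose K : R := `|r| ^+ 2 / 2; have K0 : 0 <= K by rewrite divr_ge0 ?sqr_ge0.
apply: (@eq_of_half_pow _ _ (C + (1 + K) * C)); first by rewrite addr_ge0 ?mulr_ge0// addr_ge0.
move=> j; pose d := C / 2 ^+ j; have d0 : 0 <= d by rewrite divr_ge0 ?exprn_ge0.
have aj := profile_iter_admissible m j.
have near1 s : `|s| <= `|r| -> phi s <= (1 + d) * profile_iter m j s.
  move=> /(HC s j); rewrite ler_norml => /andP[h1 h2].
  have /(ler_wpM2r d0) := aj.2 s; rewrite /d in h1 h2 *; lra.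
have near2 s : `|s| <= `|r| -> profile_iter m j s <= (1 + d) * phi s.
  move=> /(HC s j); rewrite ler_norml => /andP[h1 h2].
  have /(ler_wpM2r d0) := aphi.2 s; rewrite /d in h1 h2 *; lra.
have t1 := profile_map_antitone m0 d0 aphi aj near1 (lexx _).
have t2 := profile_map_antitone m0 d0 aj aphi near2 (lexx _).
have d20 : 0 <= d / 2 by rewrite divr_ge0.
have hK : 1 + r ^+ 2 / 2 <= 1 + K by rewrite /K real_normK ?num_real.
have t3 := le_of_ratio d20 (le_trans (profile_map_le m r aj) hK)
  (le_trans (profile_map_le m r aphi) hK) t1 t2.
have t4 := HC r j.+1 (lexx _).
have e1 : C / 2 ^+ j.+1 = d / 2 by rewrite /d [2 ^+ j.+1]exprS; field; rewrite expf_neq0.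
have -> : (C + (1 + K) * C) / 2 ^+ j = d + (1 + K) * d by rewrite /d; ring.
rewrite e1 in t4; move: t3 t4 (mulr_ge0 (addr_ge0 ler01 K0) d0).
rewrite -[profile_map m (profile_iter m j)]/(profile_iter m j.+1).
move: (profile_iter m j.+1 r) (profile_map m phi r) (phi r) => y z x.
have := ler_normD (x - y) (y - z); rewrite addrA subrK.
by clear -d0; lra.
Qed.

End FixedPoint.

(** * The profile: smoothness and differential equation *)

Section Profile.
Variable R : realType.
Implicit Types (f g h phi q : R -> R) (r : R) (m k : nat).

Lemma is_derive_fixed_profile m phi r : admissible phi ->
  (forall r, phi r = profile_map m phi r) ->
  is_derive r 1 phi (r * slope m phi r).
Proof.
move=> aphi fix_phi.
have e : phi = fun s => 1 + 2^-1 * (average 1 (slope m phi) s * s ^+ 2).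
  by apply/funext => s; rewrite [LHS]fix_phi /profile_map; ring.
have dP := is_derive_pow_average 1 r (slope_continuous (m := m) aphi).
rewrite [X in is_derive _ _ X _]e.
have H := is_derive_add (is_derive_cst (1 : R) r 1) (is_derive_mulcl 2^-1 dP).
apply: (is_derive_eq H).
by rewrite /weighted add0r expr1 !mulrA mulVf ?mul1r ?pnatr_eq0.
Qed.

(** Bootstrap: phi and its slope are equally regular, and D phi is the slope. *)
Lemma fixed_profile_smooth m phi k : admissible phi ->
  (forall r, phi r = profile_map m phi r) ->
  radial_Ck k phi /\ radial_Ck k (slope m phi).
Proof.
move=> aphi fix_phi.
have phi0 r : 0 < phi r by rewrite (lt_le_trans ltr01)//; case: aphi.
have slopeC j : radial_Ck j phi -> radial_Ck j (slope m phi).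
  move=> Cphi; apply: radial_Ck_powR => [r|]; first exact: average_inv_gt0.
  apply: radial_Ck_average.
  rewrite (_ : (fun _ => _) = fun s => phi s `^ (-1)).
    exact: radial_Ck_powR.
  by apply/funext => s; rewrite powR_inv1// ltW.
suff Cphi : radial_Ck k phi by split=> //; exact: slopeC.
elim: k => [|k IH]; first by split=> //; case: aphi.
split; first by case: aphi.
by exists (slope m phi); [exact: slopeC|move=> r; exact: is_derive_fixed_profile].
Qed.

(** Differentiating r^(m+1) q^(m+1) = r^(m+1) A_m (1/phi), where q is the slope,
and dividing by (m+1) r^m; at r = 0 both sides are read off from q^(m+1). *)
Lemma slope_ode m phi q1 r : admissible phi ->
  (forall r, is_derive r 1 (slope m phi) (r * q1 r)) ->
  slope m phi r ^+ m * (slope m phi r + r ^+ 2 * q1 r) = (phi r)^-1.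
Proof.
move=> aphi dq; set q := slope m phi.
have cinv := admissible_inv_continuous aphi.
have qn s : q s ^+ m.+1 = average m (fun s => (phi s)^-1) s.
  rewrite -powR_mulrn ?powR_ge0// /q /slope -powRrM mulVf ?pnatr_eq0// powRr1//.
  exact/ltW/average_inv_gt0.
have [->|r0] := eqVneq r 0.
  by rewrite expr0n/= mul0r addr0 -exprSr qn /average eqxx.
have := is_derive_pow_average m r cinv.
rewrite (_ : (fun s => _) = fun s => q s ^+ m.+1 * s ^+ m.+1); last first.
  by apply/funext => s; rewrite qn.
have := is_derive_mul (is_derive_exprS m (dq r)) (is_derive_pow m r).
move=> /(@derive_val _ _ _ _ _ _ _) e1 /(@derive_val _ _ _ _ _ _ _).
rewrite e1 /weighted -/q => e.
have c0 : m.+1%:R * r ^+ m != 0 by rewrite mulf_neq0 ?expf_neq0// pnatr_eq0.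
by apply: (mulfI c0); rewrite -e !exprS; ring.
Qed.

Lemma radial_profile m : (0 < m)%N ->
  exists phi q q1 : R -> R,
  [/\ forall k, radial_Ck k phi,
      [/\ forall r, 1 <= phi r, forall r, 0 < q r & continuous q1],
      forall r, is_derive r 1 phi (r * q r),
      forall r, is_derive r 1 q (r * q1 r)
    & forall r, q r ^+ m * (q r + r ^+ 2 * q1 r) = (phi r)^-1].
Proof.
move=> m0; have [phi aphi fix_phi] := @profile_exists R m m0.
have [_ [_ [q1 Cq1 dq]]] := fixed_profile_smooth 1 aphi fix_phi.
exists phi, (slope m phi), q1; split=> //.
- by move=> k; case: (fixed_profile_smooth k aphi fix_phi).
- by split; [case: aphi|move=> r; exact: slope_gt0|by case: Cq1].
- by move=> r; exact: is_derive_fixed_profile.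
- by move=> r; exact: slope_ode.
Qed.

End Profile.

(** * Rank one perturbations of scalar matrices, and the Euclidean norm *)

(** The matrix determinant lemma, from the two block eliminations of
[[1, r], [-c, a]]. *)
Lemma det_scalar_add_rank1 (F : fieldType) m (a : F) (c : 'cV[F]_m.+1) (r : 'rV[F]_m.+1) :
  a != 0 ->
  \det (a%:M + c *m r) = a ^+ m * (a + (r *m c) 0 0).
Proof.
move=> a0; pose M : 'M[F]_(1 + m.+1) := block_mx 1%:M r (- c) a%:M.
have detM : \det M = \det (a%:M + c *m r).
  have e : block_mx 1%:M 0 c 1%:M *m M = block_mx 1%:M r 0 (a%:M + c *m r).
    by rewrite mulmx_block !mul1mx !mul0mx !addr0 mulmx1 subrr addrC.
  have := congr1 determinant e.
  by rewrite det_mulmx det_lblock det_ublock !det1 !mul1r.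
have e : M *m block_mx a%:M 0 c 1%:M = block_mx (a%:M + r *m c) r 0 a%:M.
  rewrite mulmx_block !mul1mx !mulmx0 !add0r !mulmx1 mulNmx.
  by rewrite mul_mx_scalar mul_scalar_mx addNr.
have := congr1 determinant e.
rewrite det_mulmx det_lblock det_ublock !det_scalar expr1n mulr1 expr1 detM.
rewrite det_mx11 !mxE eqxx mulr1n => h.
by apply: (mulIf a0); rewrite h exprSr; ring.
Qed.

Section EuclideanNorm.
Variables (R : realType) (n : nat).
Implicit Types (x y : 'rV[R]_n) (f h : R -> R) (r : R).

Lemma enorm_ge0 x : 0 <= enorm x.
Proof. exact: sqrtr_ge0. Qed.

Lemma sqr_enorm x : enorm x ^+ 2 = \sum_i x ord0 i ^+ 2.
Proof. by rewrite sqr_sqrtr// sumr_ge0// => i _; exact: sqr_ge0. Qed.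

Lemma enorm_continuous : continuous (@enorm R n).
Proof.
have csum (s : seq 'I_n) :
    continuous (fun x : 'rV[R]_n => \sum_(i <- s) x ord0 i ^+ 2).
  elim: s => [|i s IH].
    have -> : (fun x : 'rV[R]_n => \sum_(i <- [::]) x ord0 i ^+ 2) = cst 0.
      by apply/funext => y; rewrite big_nil.
    exact: cst_continuous.
  have -> : (fun x : 'rV[R]_n => \sum_(j <- i :: s) x ord0 j ^+ 2) =
      fun y => y ord0 i * y ord0 i + \sum_(j <- s) y ord0 j ^+ 2.
    by apply/funext => y; rewrite big_cons expr2.
  move=> x; have cx := @coord_continuous R 1 n ord0 i x.
  exact: (cvgD (cvgM cx cx) (IH x)).
move=> x; apply: (@continuous_comp _ _ _ (fun y : 'rV[R]_n => \sum_i y ord0 i ^+ 2)).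
  exact: csum.
exact: sqrt_continuous.
Qed.

Lemma sqr_enorm_lin (a b : R) x y :
  enorm (a *: x + b *: y) ^+ 2 =
  a ^+ 2 * enorm x ^+ 2 + 2 * a * b * (\sum_i x ord0 i * y ord0 i)
  + b ^+ 2 * enorm y ^+ 2.
Proof.
rewrite !sqr_enorm !mulr_sumr -!big_split/=; apply: eq_bigr => i _.
by rewrite !mxE; ring.
Qed.

(** Expanding | |y| x - |x| y |^2 >= 0. *)
Lemma enorm_cauchy_schwarz x y : \sum_i x ord0 i * y ord0 i <= enorm x * enorm y.
Proof.
have [x0 y0] := (enorm_ge0 x, enorm_ge0 y).
have vanish (z : 'rV[R]_n) i : enorm z = 0 -> z ord0 i = 0.
  move=> z0; have := sqr_enorm z; rewrite z0 expr0n/= => /esym/eqP.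
  rewrite psumr_eq0 => [/allP/(_ i)|j _]; last exact: sqr_ge0.
  by rewrite mem_index_enum sqrf_eq0 => /(_ isT)/eqP.
have [xe|xn] := eqVneq (enorm x) 0.
  by rewrite xe mul0r big1// => i _; rewrite (vanish x)// mul0r.
have [ye|yn] := eqVneq (enorm y) 0.
  by rewrite ye mulr0 big1// => i _; rewrite (vanish y)// mulr0.
have xy0 : 0 < enorm x * enorm y by rewrite mulr_gt0 ?lt0r ?xn ?yn.
have := sqr_ge0 (enorm (enorm y *: x + - enorm x *: y)).
rewrite sqr_enorm_lin; set s := \sum_i _ => h.
suff : 0 <= (enorm x * enorm y) * (enorm x * enorm y - s).
  by rewrite pmulr_rge0// subr_ge0.
by rewrite -(pmulr_rge0 _ (ltr0Sn R 1)); move: h; congr (_ <= _); ring.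
Qed.

Lemma enorm_convex (a b : R) x y : 0 <= a -> 0 <= b ->
  enorm (a *: x + b *: y) <= a * enorm x + b * enorm y.
Proof.
move=> a0 b0.
have h0 : 0 <= a * enorm x + b * enorm y by rewrite addr_ge0// mulr_ge0// enorm_ge0.
rewrite -ler_sqr ?nnegrE ?enorm_ge0// sqr_enorm_lin.
have := ler_wpM2l (mulr_ge0 (mulr_ge0 (ler0n R 2) a0) b0) (enorm_cauchy_schwarz x y).
by rewrite sqrrD !exprMn; lra.
Qed.

Lemma sqr_enorm_shift (t : R) x i :
  enorm (t *: delta_mx ord0 i + x) ^+ 2 = enorm x ^+ 2 + (2 * t * x ord0 i + t ^+ 2).
Proof.
rewrite !sqr_enorm (bigD1 i)//= [in RHS](bigD1 i)//= !mxE !eqxx/= mulr1.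
rewrite (eq_bigr (fun j => x ord0 j ^+ 2)); first ring.
by move=> j ji; rewrite !mxE eqxx (negbTE ji) mulr0 add0r.
Qed.

(** Since |x + t e_i|^2 = |x|^2 + 2 t x_i + t^2, the mean value theorem against
r^2 gives the difference quotient as h(c_t) (x_i + t/2) with c_t between |x|
and |x + t e_i|.  The origin requires no separate treatment. *)
Lemma is_derive_radial f h x i : continuous h ->
  (forall r, is_derive r 1 f (r * h r)) ->
  is_derive x (delta_mx ord0 i) (fun y => f (enorm y)) (x ord0 i * h (enorm x)).
Proof.
move=> ch df; apply: is_derive_of_cvg; set e := delta_mx ord0 i.
have H t : exists c, Num.min (enorm x) (enorm (t *: e + x)) <= c
      <= Num.max (enorm x) (enorm (t *: e + x)) /\
    f (enorm (t *: e + x)) - f (enorm x) = h c * (t * x ord0 i + t ^+ 2 / 2).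
  have [|c c1 ->] := @radial_MVT R f h (enorm x) (enorm (t *: e + x)) _ df.
    by rewrite mulr_ge0 ?enorm_ge0.
  by exists c; split=> //; rewrite sqr_enorm_shift; congr (_ * _); field.
pose c t := sval (cid (H t)); have cP t := svalP (cid (H t)).
have cc : c t @[t --> 0^'] --> enorm x.
  apply/cvgrPdist_lt => d d0.
  have ct : enorm (t *: e + x) @[t --> (0 : R)^'] --> enorm x.
    apply: cvg_within_filter.
    rewrite -[X in _ --> enorm X](add0r x) -(scale0r e).
    apply: (@continuous_comp R _ _ (fun t : R => t *: e + x) (@enorm R n) 0).
      by apply: cvgD; [exact: scalel_continuous|exact: cvg_cst].
    exact: enorm_continuous.
  move/cvgrPdist_lt : ct => /(_ _ d0); apply: filterS => t.
  have [] := cP t; rewrite -/(c t).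
  case: (leP (enorm x) (enorm (t *: e + x))) => ? /andP[? ?] _;
    by rewrite !ltr_norml => /andP[? ?]; apply/andP; split; lra.
have lim : h (c t) * (x ord0 i + t / 2) @[t --> (0 : R)^'] --> h (enorm x) * (x ord0 i + 0 / 2).
  apply: cvgM; first by apply: continuous_cvg; [exact: ch|exact: cc].
  apply: cvg_within_filter; apply: cvgD; first exact: cvg_cst.
  by apply: cvgM; [exact: cvg_id|exact: cvg_cst].
move: lim; rewrite mul0r addr0 mulrC; apply: cvg_trans; apply: near_eq_cvg.
near=> t; have t0 : t != 0 by near: t; exact: nbhs_dnbhs_neq.
have [_ ->] := cP t; rewrite -/(c t) /GRing.scale/=; field.
Unshelve. all: by end_near. Qed.

Lemma is_derive_coord x i j :
  is_derive x (delta_mx ord0 i) (fun y => y ord0 j) (i == j)%:R.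
Proof.
apply: is_derive_of_cvg; apply: cvg_near_cst.
near=> t; have t0 : t != 0 by near: t; exact: nbhs_dnbhs_neq.
by rewrite !mxE addrK eqxx/= eq_sym /GRing.scale/= mulrA mulVf// mul1r.
Unshelve. all: by end_near. Qed.

End EuclideanNorm.

(** * Smooth functions on the lower half-space *)

Section HalfSpace.
Variables (R : realType) (n : nat).
Implicit Types (u v : 'rV[R]_n * R -> R) (p : 'rV[R]_n * R).

Lemma time_filter_proper p : p.2 <= 0 -> ProperFilter (time_filter p).
Proof.
move=> p0; apply: Build_ProperFilter.
rewrite /time_filter /within/= /dnbhs /within/= => /nbhs_normP[d /= d0 H].
apply: (H (p.2 - d / 2)) => /=.
- by rewrite opprB addrCA subrr addr0 gtr0_norm; lra.
- by apply/eqP; lra.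
- lra.
Qed.

(** A two-sided derivative also computes the one-sided quotient at t = 0. *)
Lemma time_quotient_cvg u p (d : R) : is_derive p.2 1 (fun t => u (p.1, t)) d ->
  time_quotient u p @ time_filter p --> d.
Proof.
case: p => x t /= du; have [dd <-] := du.
have /cvgrPdist_lt H : (fun h => h^-1 *: (u (x, h *: 1 + t) - u (x, t))) @ 0^' -->
    'D_1 (fun t => u (x, t)) t by exact: dd.
apply/cvgrPdist_lt => e /H.
rewrite /time_filter !near_withinE /dnbhs/= => /nbhs_normP[/= a a0 Ha].
apply/nbhs_normP; exists a => //= s /= st s0 _.
have := Ha (s - t); rewrite /= sub0r normrN distrC => /(_ st); rewrite subr_eq0 => /(_ s0).
by rewrite [(s - t) *: 1]mulr1 subrK /time_quotient/= [_ / _]mulrC.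
Qed.

(** The derivatives dx and dt at points of the half-space only see the values
there, so they can be computed on any other function with these values; this is
what allows differentiating repeatedly with explicit formulas. *)
Lemma eq_on_derive_x u v p i (d : R) : p.2 <= 0 ->
  (forall p, p.2 <= 0 -> u p = v p) ->
  is_derive p.1 (delta_mx ord0 i) (fun x => v (x, p.2)) d ->
  derivable_x i u p /\ dx i u p = d.
Proof.
move=> p0 uv; rewrite /derivable_x /dx.
have -> : (fun x => u (x, p.2)) = fun x => v (x, p.2) by apply/funext => x; exact: uv.
by case.
Qed.

Lemma eq_on_derive_t u v p (d : R) : p.2 <= 0 ->
  (forall p, p.2 <= 0 -> u p = v p) ->
  is_derive p.2 1 (fun t => v (p.1, t)) d ->
  derivable_t u p /\ dt u p = d.
Proof.
move=> p0 uv /time_quotient_cvg H.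
have PF := time_filter_proper p0.
suff Hu : time_quotient u p @ time_filter p --> d.
  by split; [exact: cvgP Hu|exact: cvg_lim Hu].
apply: cvg_trans H; apply: near_eq_cvg.
rewrite near_withinE; apply: nearW => s /= s0.
by rewrite /time_quotient (uv (p.1, s))// (uv p).
Qed.

(** A class containing the solution, stable under all first order derivatives up
to the loss of one unit of k, and made of functions continuous on the closed
half-space.  The time factors are powers of an affine function that is positive
for t < 1, hence differentiable on both sides of t = 0. *)
Inductive separated_Ck k : ('rV[R]_n * R -> R) -> Prop :=
| separated_radial f : radial_Ck k f -> separated_Ck k (fun p => f (enorm p.1))
| separated_coord i : separated_Ck k (fun p => p.1 ord0 i)
| separated_time c a : 0 < c -> separated_Ck k (fun p => (c * (1 - p.2)) `^ a)
| separated_add u v : separated_Ck k u -> separated_Ck k v ->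
    separated_Ck k (fun p => u p + v p)
| separated_mul u v : separated_Ck k u -> separated_Ck k v ->
    separated_Ck k (fun p => u p * v p).

Lemma separated_CkS k u : separated_Ck k.+1 u -> separated_Ck k u.
Proof.
elim=> {u} [f hf|i|c a c0|u v _ hu _ hv|u v _ hu _ hv].
- by apply: separated_radial; exact: radial_CkS.
- exact: separated_coord.
- exact: separated_time.
- exact: separated_add.
- exact: separated_mul.
Qed.

Lemma separated_cst k (c : R) : separated_Ck k (fun=> c).
Proof. exact: (separated_radial (radial_Ck_cst k c)). Qed.

Lemma is_derive_time (c a t : R) : 0 < c -> t <= 0 ->
  is_derive t 1 (fun s => (c * (1 - s)) `^ a)
    (- (c * a) * (c * (1 - t)) `^ (a - 1)).
Proof.
move=> c0 t0; have ct : 0 < c * (1 - t) by rewrite mulr_gt0//; lra.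
have dc : is_derive t 1 (fun s => c * (1 - s)) (c * (0 - 1)).
  by apply: is_derive_mulcl; apply: is_deriveB.
by have H := is_derive_powR (f := fun s => c * (1 - s)) a ct dc; apply: (is_derive_eq H); ring.
Qed.

Lemma separated_continuous k u p : separated_Ck k u -> p.2 <= 0 ->
  {for p, continuous u}.
Proof.
move=> + p0; elim=> {u} [f hf|i|c a c0|u v _ hu _ hv|u v _ hu _ hv].
- apply: (@continuous_comp _ _ _ (fun q : 'rV[R]_n * R => enorm q.1) f).
    by apply: (@continuous_comp _ _ _ fst (@enorm R n)); [exact: cvg_fst|exact: enorm_continuous].
  exact: radial_Ck_continuous hf _.
- by apply: (@continuous_comp _ _ _ fst (fun x : 'rV[R]_n => x ord0 i));
    [exact: cvg_fst|exact: coord_continuous].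
- apply: (@continuous_comp _ R R snd (fun t : R => (c * (1 - t)) `^ a)); first exact: cvg_snd.
  exact: is_derive1_continuous (is_derive_time a c0 p0).
- by apply: cvgD; [exact: hu|exact: hv].
- by apply: cvgM; [exact: hu|exact: hv].
Qed.

Lemma separated_dx k u i : separated_Ck k.+1 u ->
  exists2 u', separated_Ck k u' &
    forall p, p.2 <= 0 -> is_derive p.1 (delta_mx ord0 i) (fun x => u (x, p.2)) (u' p).
Proof.
elim=> {u} [f [_ [h hh df]]|j|c a c0|u v _ [u' hu du] _ [v' hv dv]|
            u v su [u' hu du] sv [v' hv dv]].
- exists (fun p => p.1 ord0 i * h (enorm p.1)).
    by apply: separated_mul; [exact: separated_coord|exact: separated_radial].
  by move=> p _; apply: is_derive_radial => //; exact: radial_Ck_continuous hh.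
- exists (fun=> (i == j)%:R); first exact: separated_cst.
  by move=> p _; exact: is_derive_coord.
- exists (fun=> 0); first exact: separated_cst.
  by move=> p _; exact: (is_derive_cst ((c * (1 - p.2)) `^ a)).
- exists (fun p => u' p + v' p); first exact: separated_add.
  by move=> p p0; apply: is_derive_add; [exact: du|exact: dv].
- exists (fun p => u' p * v p + u p * v' p).
    by apply: separated_add; apply: separated_mul => //; exact: separated_CkS.
  move=> [x t] p0; exact: is_derive_mul (du _ p0) (dv _ p0).
Qed.

Lemma separated_dt k u : separated_Ck k.+1 u ->
  exists2 u', separated_Ck k u' &
    forall p, p.2 <= 0 -> is_derive p.2 1 (fun t => u (p.1, t)) (u' p).
Proof.
elim=> {u} [f hf|j|c a c0|u v _ [u' hu du] _ [v' hv dv]|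
            u v su [u' hu du] sv [v' hv dv]].
- exists (fun=> 0); first exact: separated_cst.
  by move=> p _; exact: (is_derive_cst (f (enorm p.1))).
- exists (fun=> 0); first exact: separated_cst.
  by move=> p _; exact: (is_derive_cst (p.1 ord0 j)).
- exists (fun p => - (c * a) * (c * (1 - p.2)) `^ (a - 1)).
    by apply: separated_mul; [exact: separated_cst|exact: separated_time].
  by move=> p p0; exact: is_derive_time.
- exists (fun p => u' p + v' p); first exact: separated_add.
  by move=> p p0; apply: is_derive_add; [exact: du|exact: dv].
- exists (fun p => u' p * v p + u p * v' p).
    by apply: separated_add; apply: separated_mul => //; exact: separated_CkS.
  move=> [x t] p0; exact: is_derive_mul (du _ p0) (dv _ p0).
Qed.

Lemma Ck_separated k u v : separated_Ck k v ->
  (forall p, p.2 <= 0 -> u p = v p) -> Ck k u.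
Proof.
have cont j w z : separated_Ck j z -> (forall p, p.2 <= 0 -> w p = z p) ->
    {within lower_half_space (n := n), continuous w}.
  move=> sz wz; apply: (@subspace_eq_continuous _ (lower_half_space (n := n)) _ z).
    by move=> p; rewrite inE => p0; symmetry; exact: wz.
  by apply: continuous_in_subspaceT => p /[!inE] p0; exact: separated_continuous sz p0.
elim: k u v => [|k IH] u v sv uv; split=> //; try exact: cont sv uv.
have [v' sv' dv] := separated_dt sv.
split=> [i p p0|p p0|i|].
- have [w _ dw] := separated_dx i sv.
  by have [] := eq_on_derive_x p0 uv (dw p p0).
- by have [] := eq_on_derive_t p0 uv (dv p p0).
- have [w sw dw] := separated_dx i sv.
  by apply: (IH _ w sw) => p p0; have [] := eq_on_derive_x p0 uv (dw p p0).
- by apply: (IH _ v' sv') => p p0; have [] := eq_on_derive_t p0 uv (dv p p0).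
Qed.

End HalfSpace.

(** * Convexity from the monotonicity of the derivative *)

Section Convexity.
Variable R : realType.
Implicit Types (f df : R -> R) (a b t : R).

Lemma le_of_derive_ge0 f df a b : (forall r : R, is_derive r 1 f (df r)) ->
  (forall r, a <= r <= b -> 0 <= df r) -> a <= b -> f a <= f b.
Proof.
move=> dfE df0 ab; have [|c] := MVT_segment ab (fun x _ => dfE x).
  by apply: continuous_subspaceT => x; exact: is_derive1_continuous (dfE x).
by rewrite in_itv/= => cab e; rewrite -subr_ge0 e mulr_ge0 ?df0// subr_ge0.
Qed.

Lemma convex_of_derive_homo f df a b t : (forall r : R, is_derive r 1 f (df r)) ->
  {homo df : x y / x <= y} -> 0 <= t -> t <= 1 ->
  f (t * a + (1 - t) * b) <= t * f a + (1 - t) * f b.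
Proof.
move=> dfE mdf; wlog ab : a b t / a <= b => [H t0 t1|t0 t1].
  case/orP: (le_total a b) => ab; first exact: H.
  have := H b a (1 - t) ab; rewrite (_ : 1 - (1 - t) = t); last ring.
  rewrite [_ + t * a]addrC [_ + t * f a]addrC.
  by apply; lra.
have cf x y : {within `[x, y], continuous f}.
  by apply: continuous_subspaceT => z; exact: is_derive1_continuous (dfE z).
pose z := t * a + (1 - t) * b.
have ez : z - a = (1 - t) * (b - a) by rewrite /z; ring.
have eb : b - z = t * (b - a) by rewrite /z; ring.
have s1 : 0 <= 1 - t by lra.
have az : a <= z by rewrite -subr_ge0 ez mulr_ge0// subr_ge0.
have zb : z <= b by rewrite -subr_ge0 eb mulr_ge0// subr_ge0.
have [c1] := MVT_segment az (fun x _ => dfE x) (cf _ _).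
have [c2] := MVT_segment zb (fun x _ => dfE x) (cf _ _).
rewrite !in_itv/= => /andP[zc2 _] e2 /andP[_ c1z] e1.
have c12 := mdf _ _ (le_trans c1z zc2).
have K0 : 0 <= t * (1 - t) * (b - a) by rewrite !mulr_ge0// subr_ge0.
have := ler_wpM2l K0 c12; rewrite -/z.
rewrite ez in e1; rewrite eb in e2.
have h1 : t * (f z - f a) = t * (1 - t) * (b - a) * df c1 by rewrite e1; ring.
have h2 : (1 - t) * (f b - f z) = t * (1 - t) * (b - a) * df c2 by rewrite e2; ring.
by rewrite -h1 -h2; clear; lra.
Qed.

End Convexity.

(** * The solution *)

Theorem theorem1p2 (R : realType) (n : nat) (hn : (2 <= n)%N) :
  exists u1 : 'rV[R]_n * R -> R,
    [/\ smooth u1,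
        parabolically_convex u1,
        forall (x : 'rV[R]_n) (t : R), t <= 0 ->
          - dt u1 (x, t) * \det (hessian u1 (x, t)) = 1,
        ~ (exists m1 m2 : R, [/\ 0 < m1, 0 < m2 &
             forall (x : 'rV[R]_n) (t : R), t <= 0 ->
               - m1 <= dt u1 (x, t) /\ dt u1 (x, t) <= - m2])
      & exists (w : R -> R) (phi : R -> R),
          forall (x : 'rV[R]_n) (t : R), t <= 0 ->
            u1 (x, t) = w t * phi (enorm x)].
Proof.
case: n hn => [//|m] m0.
have [phi [q [q1 [Cphi [phi1 q0 cq1] dphi dq ode]]]] := @radial_profile R m m0.
have phi0 r : 0 < phi r by exact: lt_le_trans ltr01 (phi1 r).
have cq : continuous q by move=> r; exact: is_derive1_continuous (dq r).
pose N : R := m.+2%:R; have N0 : 0 < N by rewrite ltr0n.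
pose B t := N * (1 - t).
have B1 t : t <= 0 -> 1 <= B t.
  move=> t0; have N1 : 1 <= N by rewrite ler1n.
  by have := ler_wpM2l (ltW N0) (_ : 1 <= 1 - t); rewrite mulr1 /B; lra.
have B0 t : t <= 0 -> 0 < B t by move=> /B1; exact: lt_le_trans.
pose w t := B t `^ N^-1.
have w0 t : t <= 0 -> 0 < w t by move=> t0; rewrite powR_gt0// B0.
pose u (p : 'rV[R]_m.+1 * R) := w p.2 * phi (enorm p.1).
have Su k : separated_Ck k u.
  by apply: separated_mul; [exact: separated_time|exact: separated_radial].
have smooth_u : smooth u by move=> k; exact: Ck_separated (Su k) (fun _ _ => erefl).
have dtu p : p.2 <= 0 -> dt u p = - (B p.2 `^ (N^-1 - 1) * phi (enorm p.1)).
  move=> p0; suff H : is_derive p.2 1 (fun t => u (p.1, t))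
      (- (B p.2 `^ (N^-1 - 1) * phi (enorm p.1))).
    by have [] := eq_on_derive_t (u := u) (v := u) p0 (fun _ _ => erefl) H.
  have H := is_derive_mul (is_derive_time N^-1 N0 p0) (is_derive_cst (phi (enorm p.1)) _ _).
  by apply: (is_derive_eq H); rewrite mulr0 addr0 mulfV ?gt_eqF// !mulN1r mulNr.
have dxu j p : p.2 <= 0 -> dx j u p = w p.2 * (p.1 ord0 j * q (enorm p.1)).
  move=> p0.
  have H := is_derive_mulcl (w p.2) (is_derive_radial p.1 j cq dphi).
  by have [] := eq_on_derive_x (u := u) (v := u) p0 (fun _ _ => erefl) H.
have hess p : p.2 <= 0 -> hessian u p =
    w p.2 *: ((q (enorm p.1))%:M + (q1 (enorm p.1) *: p.1^T) *m p.1).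
  move=> p0; apply/matrixP => i j; rewrite mxE.
  have H := is_derive_mulcl (w p.2)
    (is_derive_mul (is_derive_coord p.1 i j) (is_derive_radial p.1 i cq1 dq)).
  have [_ ->] := eq_on_derive_x (u := dx j u)
    (v := fun p => w p.2 * (p.1 ord0 j * q (enorm p.1))) p0 (dxu j) H.
  by rewrite !mxE big_ord1 !mxE -mulr_natl; ring.
have det_hess p : p.2 <= 0 -> \det (hessian u p) = w p.2 ^+ m.+1 / phi (enorm p.1).
  move=> p0; rewrite hess// detZ det_scalar_add_rank1 ?gt_eqF//.
  suff -> : (p.1 *m (q1 (enorm p.1) *: p.1^T)) 0 0 = enorm p.1 ^+ 2 * q1 (enorm p.1).
    by rewrite ode.
  rewrite -scalemxAr mxE mulrC sqr_enorm mxE; congr (_ * _).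
  by apply: eq_bigr => i _; rewrite mxE expr2.
exists u; split=> //.
- split.
  + by have [] := smooth_u 0%N.
  + move=> t t0 a x y _ _.
    rewrite /= /u /= -[X in _ <= X]/(a%:inum * (w t * phi (enorm x)) +
      (1 - a%:inum) * (w t * phi (enorm y))).
    rewrite [X in _ <= X](_ : _ = w t *
      (a%:inum * phi (enorm x) + (1 - a%:inum) * phi (enorm y))); last ring.
    have a0 : 0 <= a%:inum :> R by [].
    have a1 : 0 <= 1 - a%:inum :> R by rewrite subr_ge0.
    apply: ler_wpM2l; first exact/ltW/w0.
    (* The equation gives (r q)' = q + r^2 q1 = 1 / (q^m phi) > 0. *)
    have dphi_homo : {homo (fun r => r * q r) : x y / x <= y}.
      move=> r s; apply: (@le_of_derive_ge0 R (fun r => r * q r) (fun r => q r + r ^+ 2 * q1 r)).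
        move=> z; have H := is_derive_mul (is_derive_id z 1) (dq z).
        by apply: (is_derive_eq H); ring.
      move=> z _; have := ode z; have qm := exprn_gt0 m (q0 z) => e.
      by rewrite ltW// -(pmulr_rgt0 _ qm) e invr_gt0.
    apply: le_trans (convex_of_derive_homo _ _ dphi dphi_homo a0 _); last by rewrite -subr_ge0.
    have e0 := enorm_ge0 (a%:inum *: x + (1 - a%:inum) *: y).
    apply: le_of_derive_ge0 dphi _ (enorm_convex x y a0 a1).
    by move=> r /andP[r0 _]; rewrite mulr_ge0 ?(ltW (q0 _))// (le_trans e0).
  + move=> x s t st t0; rewrite /u /= ler_wpM2r ?(ltW (phi0 _))//.
    have s0 : s <= 0 by exact: le_trans st t0.
    apply: ge0_ler_powR; rewrite ?invr_ge0 ?nnegrE ?(ltW N0) ?(ltW (B0 _ _))//.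
    by apply: ler_wpM2l; [exact: ltW|lra].
- move=> x t t0; rewrite dtu// det_hess//= opprK /w.
  rewrite -powR_mulrn ?powR_ge0// -powRrM.
  rewrite [LHS](_ : _ = B t `^ (N^-1 - 1) * B t `^ (N^-1 * m.+1%:R)); last first.
    by field; rewrite gt_eqF.
  rewrite -powRD; last by rewrite (gt_eqF (B0 t t0)) implybT.
  rewrite (_ : N^-1 - 1 + _ = 0) ?powRr0//.
  by rewrite addrAC -{1}[N^-1]mulr1 -mulrDr nat1r mulVf ?subrr// gt_eqF.
- move=> [m1 [m2 [_ m20 H]]].
  (* As B >= 1 and 1/N - 1 <= -1/2, it is enough that B^(-1/2) c < m2, that is
     B > (c/m2)^2; this time satisfies it because N >= 1. *)
  pose c := phi (enorm (0 : 'rV[R]_m.+1)); pose t := - (c / m2) ^+ 2.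
  have t0 : t <= 0 by rewrite oppr_le0 sqr_ge0.
  have [_] := H 0 t t0; rewrite dtu//= lerN2 leNgt => /negP; apply.
  rewrite -/c.
  have cm0 : 0 <= c / m2 by rewrite divr_ge0 ?(ltW m20) ?(ltW (phi0 _)).
  have hB : c / m2 < B t `^ 2^-1.
    rewrite powR12_sqrt ?ltW ?B0// -[c / m2]ger0_norm// -sqrtr_sqr ltr_sqrt ?B0//.
    have N1 : 1 <= N by rewrite ler1n.
    have t1 : 0 <= 1 - t by rewrite subr_ge0 (le_trans t0).
    apply: lt_le_trans (ler_wpM2r t1 N1).
    by rewrite mul1r /t opprK ltr_pwDl.
  have hN : N^-1 - 1 <= - 2^-1.
    suff : N^-1 <= 2^-1 by move: (N^-1) => z; clear; lra.
    by rewrite lef_pV2 ?posrE// ler_nat.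
  apply: le_lt_trans (_ : B t `^ (- 2^-1) * c < m2).
    by rewrite ler_wpM2r ?(ltW (phi0 _))// ler_powR// B1.
  by rewrite powRN mulrC ltr_pdivrMr ?powR_gt0 ?B0// mulrC -ltr_pdivrMr.
- by exists w, phi.
Qed.
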